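(* Let $G$ be a finite group, let $(\{\mathfrak{S}^{A}\}_A,\{\mathfrak{O}^{A\to B}\}_{A,B})$ be a resource theory satisfying tensor closure, ancilla preparation, closure under discarding and convexity, and compatible with the symmetry $(G,\{U^A\}_A)$. Let $\epsilon\in[0,1)$, let $\Delta$ be a distinguishability measure whose orthogonal distinguishability function $f_\Delta$ is strictly increasing, let $\rho$ be a state on a system $A$, and let $S=\{g\in G\mid\mathcal{U}_g(\rho)=\rho\}$ be its symmetry subgroup. Let $\{\omega_x\}_{x\in G/S}$ be a $G/S$-memory on a system $M$ satisfying the free-memory assumption. Then the following statements are equivalent: (i) For all systems $X,Y$ and every $S$-covariant free operation $\mathcal{E}\in\mathfrak{O}^{X\to Y}$ there exists a $G$-covariant free operation $\mathcal{F}\in\mathfrak{O}^{AX\to Y}$ such that for every state $\chi$ on $X$, $\Delta(\mathcal{E}(\chi),\mathcal{F}(\rho\otimes\chi))\le f_\Delta(-\log(1-\epsilon))$. (ii) For every system $B$ and every $S$-invariant free state $\sigma\in\mathfrak{S}^B$ there exists a $G$-covariant free operation $\mathcal{F}\in\mathfrak{O}^{A\to B}$ such that $\Delta(\sigma,\mathcal{F}(\rho))\le f_\Delta(-\log(1-\epsilon))$. (iii) There exists a $G$-covariant free operation $\mathcal{F}\in\mathfrak{O}^{A\to M}$ such that $\Delta(\omega_S,\mathcal{F}(\rho))\le f_\Delta(-\log(1-\epsilon))$. (iv) There exists a memory-assisted sub-POVM $\{M_x\}_{x\in G/S}$ on $A$ such that $\min_{g\in G}\mathrm{tr}(M_{gS}\,\mathcal{U}_g(\rho))\ge1-\epsilon$.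 (v) There exists a memory-assisted sub-POVM $\{M_x\}_{x\in G/S}$ on $A$ such that $\frac{1}{|G|}\sum_{g\in G}\mathrm{tr}(M_{gS}\,\mathcal{U}_g(\rho))\ge1-\epsilon$.
   Context: All systems are finite-dimensional. A resource theory consists of, for each system $A$, a set $\mathfrak{S}^A$ of (free) states and, for each pair of systems, a set $\mathfrak{O}^{A\to B}$ of (free) CPTP maps such that free operations map free states to free states, identity channels are free, and compositions of free operations are free. Further standing assumptions: (tensor closure) tensor products of free states are free and tensor products of free operations are free; (ancilla preparation) for every $\sigma\in\mathfrak{S}^X$ the map $\rho\mapsto\rho\otimes\sigma$ is in $\mathfrak{O}^{A\to AX}$; (closure under discarding) $\mathrm{tr}_X\in\mathfrak{O}^{AX\to A}$; (convexity) each $\mathfrak{O}^{A\to B}$ is convex. The trivial one-dimensional system is included among the systems and its unique state is free. Every system $A$ carries a projective unitary representation $U^A$ of $G$, with $\mathcal{U}^A_g(\cdot)=U^A(g)\cdot U^A(g)^\dagger$ (superscript omitted when clear); composite systems carry tensor-product representations. The theory is compatible with the symmetry if $\mathcal{U}^A_g(\mathfrak{S}^A)=\mathfrak{S}^A$ and $\mathcal{U}^B_g\circ\mathfrak{O}^{A\to B}\circ\mathcal{U}^A_{g^{-1}}=\mathfrak{O}^{A\to B}$ for all $g\in G$ and all $A,B$. For a subgroup $T\subset G$, $\mathcal{E}:A\to B$ is $T$-covariant if $\mathcal{E}\circ\mathcal{U}^A_g=\mathcal{U}^B_g\circ\mathcal{E}$ for all $g\in T$; a state $\sigma$ is $T$-invariant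 if $\mathcal{U}_g(\sigma)=\sigma$ for all $g\in T$. $G/S$-memory: a family of states $\{\omega_x\}_{x\in G/S}$ on a system $M$ with $\mathcal{U}_g(\omega_{hS})=\omega_{ghS}$ for all $g,h\in G$ and $\omega_{x_1}\omega_{x_2}=0$ whenever $x_1\ne x_2$. $\Pi_x$ denotes the projection onto the support of $\omega_x$. Free-memory assumption (with $X_0=G/S$): there is a state $\omega_\perp$ on $M$ with support projection $\Pi_\perp$ orthogonal to all $\Pi_x$ and $\sum_{x\in X_0}\Pi_x+\Pi_\perp=I_M$, such that: (1) free introduction: for every $y\in X_0\cup\{\perp\}$ the state $\omega_y$ is free and the preparation channel $L\mapsto\mathrm{tr}(L)\omega_y$ (from any system to $M$) is free; (2) standardization: the channel $\mathcal{D}(L)=\sum_{x\in X_0\cup\{\perp\}}\mathrm{tr}(\Pi_xL)\omega_x$ on $M$ is free; (3) conditional control: for any family of free operations $\{\mathcal{E}_y\in\mathfrak{O}^{B\to C}\}_{y\in X_0\cup\{\perp\}}$ there is a free operation $\mathcal{C}\in\mathfrak{O}^{MB\to MC}$ with $\mathcal{C}(\omega_y\otimes L)=\omega_y\otimes\mathcal{E}_y(L)$ for all $y$ and all operators $L$ on $B$. A sub-POVM is a family of positive semidefinite operators with $\sum_xM_x\le I$. A sub-POVM $\{M_x\}_{x\in G/S}$ on $A$ is memory-assisted if there is $\mathcal{E}\in\mathfrak{O}^{A\to M}$ with $M_x=\mathcal{E}^\dagger(\Pi_x)$ for all $x\in G/S$, where $\mathcal{E}^\dagger$ is the Hilbert–Schmidt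 adjoint. A distinguishability measure $\Delta$ is a family of functions on pairs of states of each finite-dimensional Hilbert space, with values in $[0,\infty]$, such that $\Delta(\rho,\sigma)\ge\Delta(\mathcal{E}(\rho),\mathcal{E}(\sigma))$ for all CPTP maps $\mathcal{E}$. Its orthogonal distinguishability function is $f_\Delta(x):=\Delta(\rho_0,e^{-x}\rho_0+(1-e^{-x})\sigma_0)$, $x\in[0,\infty]$, for any pair of orthogonal states $\rho_0,\sigma_0$ (independent of the choice). *)

(* Defs.v *)
From HB Require Import structures.
From mathcomp Require Import all_boot all_order all_fingroup all_algebra.
From mathcomp Require Import mxtens complex.
From mathcomp Require Import classical_sets reals constructive_ereal exp.

Set Implicit Arguments.
Unset Strict Implicit.
Unset Printing Implicit Defensive.

Import Order.TTheory GRing.Theory Num.Theory.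
Local Open Scope ring_scope.
Local Open Scope complex_scope.
Local Open Scope sesquilinear_scope.

(* Every finite-dimensional Hilbert space is presented as C^n with C = R[i];  *)
(* operators are square matrices acting on column vectors, and maps between   *)
(* operator spaces are plain functions.                                       *)
Section Quantum.
Variable R : realType.
Local Notation C := R[i].

(* The order of C is partial: 0 <= z means that z is real and nonnegative.    *)
Definition psd n (M : 'M[C]_n) : Prop :=
  M \is hermsymmx /\ forall v : 'cV[C]_n, 0 <= (v^t* *m M *m v) 0 0.

Definition is_state n (rho : 'M[C]_n) : Prop := psd rho /\ \tr rho = 1.

Lemma linear_expand m n (E : 'M[C]_m -> 'M[C]_n) (X : 'M[C]_m) : linear E ->
  E X = \sum_i \sum_j X i j *: E (delta_mx i j).
Proof.
move=> linE.
pose E' := HB.pack_for {linear 'M[C]_m -> 'M[C]_n} E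
  (GRing.isLinear.Build _ _ _ _ _ linE).
rewrite {1}(matrix_sum_delta X) -[E]/(E' : _ -> _) linear_sum.
by apply: eq_bigr => i _; rewrite linear_sum;
   apply: eq_bigr => j _; rewrite linearZ.
Qed.

(* The tensor product of two linear maps.                                     *)
Definition tensmap m1 n1 m2 n2 (E : 'M[C]_m1 -> 'M[C]_n1)
    (F : 'M[C]_m2 -> 'M[C]_n2) (X : 'M[C]_(m1 * m2)) : 'M[C]_(n1 * n2) :=
  \sum_(i < m1) \sum_(j < m1) \sum_(k < m2) \sum_(l < m2)
    X (mxtens_index (i, k)) (mxtens_index (j, l)) *:
      (E (delta_mx i j) *t F (delta_mx k l)).

Lemma tensmap_tens m1 n1 m2 n2 (E : 'M[C]_m1 -> 'M[C]_n1)
    (F : 'M[C]_m2 -> 'M[C]_n2) (X : 'M[C]_m1) (Y : 'M[C]_m2) :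
  linear E -> linear F -> tensmap E F (X *t Y) = E X *t F Y.
Proof.
move=> linE linF.
have EE Z := linear_expand Z linE; have FF Z := linear_expand Z linF.
apply/matrixP => a b; case: (mxtens_indexP a) => a1 a2.
case: (mxtens_indexP b) => b1 b2; rewrite tensmxE EE FF /tensmap.
rewrite !summxE mulr_suml; apply: eq_bigr => i _.
rewrite !summxE mulr_suml; apply: eq_bigr => j _.
rewrite summxE mulr_sumr; apply: eq_bigr => k _.
rewrite !summxE mulr_sumr; apply: eq_bigr => l _.
by rewrite mxE !tensmxE !mxE mulrACA.
Qed.

Definition completely_positive m n (E : 'M[C]_m -> 'M[C]_n) : Prop :=
  forall k (X : 'M[C]_(k * m)), psd X -> psd (tensmap (@id 'M[C]_k) E X).

Definition cptp m n (E : 'M[C]_m -> 'M[C]_n) : Prop :=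
  [/\ linear E, completely_positive E & forall X, \tr (E X) = \tr X].

Definition ptrace_r m n (X : 'M[C]_(m * n)) : 'M[C]_m :=
  \matrix_(i, j) \sum_(k < n) X (mxtens_index (i, k)) (mxtens_index (j, k)).

Definition ptrace_l m n (X : 'M[C]_(m * n)) : 'M[C]_n :=
  \matrix_(k, l) \sum_(i < m) X (mxtens_index (i, k)) (mxtens_index (i, l)).

(* The Hilbert-Schmidt adjoint of a linear map: its (i, j) entry is the inner *)
(* product of |i><j| with the adjoint applied to Y.                           *)
Definition hs_adjoint m n (E : 'M[C]_m -> 'M[C]_n) (Y : 'M[C]_n) : 'M[C]_m :=
  \matrix_(i, j) \tr ((E (delta_mx i j))^t* *m Y).

Lemma hs_adjointP m n (E : 'M[C]_m -> 'M[C]_n) (X : 'M[C]_m) (Y : 'M[C]_n) :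
  linear E -> \tr ((E X)^t* *m Y) = \tr (X^t* *m hs_adjoint E Y).
Proof.
move=> linE.
have EE Z := linear_expand Z linE.
rewrite EE [RHS]/mxtrace; under [RHS]eq_bigr do rewrite mxE.
rewrite [RHS]exchange_big /=.
rewrite !raddf_sum /= mulmx_suml raddf_sum /=; apply: eq_bigr => i _.
rewrite !raddf_sum /= mulmx_suml raddf_sum /=; apply: eq_bigr => j _.
by rewrite !mxE linearZ /= map_mxZ -scalemxAl mxtraceZ.
Qed.

(* For a Hermitian operator the row space used by proj_ortho and the range    *)
(* have the same orthogonal projection.                                       *)
Definition supp_proj n (M : 'M[C]_n) : 'M[C]_n := proj_ortho M.

Lemma supp_projP n (M : 'M[C]_n) (P := supp_proj M) :
  [/\ P^t* = P, P *m P = P & (P :=: M)%MS].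
Proof.
split; [|exact: proj_ortho_proj|exact: proj_orthoE].
have /orthomx1P := proj_ortho_compl_sub M (1%:M : 'M_n).
rewrite mul1mx => h1.
have [D defP] : exists D, P = D *m M.
  by apply/submxP; rewrite (proj_orthoE M).
have h2 : P^t* = P *m P^t*.
  apply/eqP; rewrite -subr_eq0 -{1}[P^t*]mul1mx -mulmxBl.
  by rewrite {2}defP trmx_mul map_mxM mulmxA h1 mul0mx.
have h3 : (P *m P^t*)^t* = P^t*^t* *m P^t* by rewrite trmx_mul map_mxM.
by rewrite {1}h2 -{1}[P in P *m _]trmxCK -h3 -h2 trmxCK.
Qed.

Record distinguishability_measure := DistinguishabilityMeasure {
  dist :> forall n, 'M[C]_n -> 'M[C]_n -> \bar R;
  dist_ge0 : forall n (rho sigma : 'M[C]_n),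
    is_state rho -> is_state sigma -> (0 <= dist rho sigma)%E;
  dist_data_processing : forall m n (E : 'M[C]_m -> 'M[C]_n)
      (rho sigma : 'M[C]_m),
    cptp E -> is_state rho -> is_state sigma ->
    (dist (E rho) (E sigma) <= dist rho sigma)%E }.

(* The orthogonal pair is |0><0|, |1><1| on C^2; by data processing any other *)
(* pair of orthogonal states gives the same value.                            *)
Definition odf (Delta : distinguishability_measure) (x : \bar R) : \bar R :=
  let p : R := fine (expeR (- x)%E) in
  let rho0 : 'M[C]_2 := delta_mx 0 0 in
  let sigma0 : 'M[C]_2 := delta_mx 1 1 in
  Delta 2%N rho0 (p%:C *: rho0 + (1 - p)%:C *: sigma0).

Definition strictly_increasing_odf (Delta : distinguishability_measure) :
    Prop :=
  forall x y : \bar R, (0 <= x)%E -> (x < y)%E -> (odf Delta x < odf Delta y)%E.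

Definition sub_povm (X : finType) n (M : X -> 'M[C]_n) : Prop :=
  (forall x, psd (M x)) /\ psd (1%:M - \sum_x M x).

End Quantum.

(* Systems are formal tensor products of elementary systems of dimensions d.  *)
(* Taking all systems as elementary, with composition as part of the          *)
(* indexing, recovers an arbitrary collection of systems; the formal          *)
(* presentation makes the dimension of a composite a product by computation.  *)
Inductive system (I : Type) :=
  | Triv
  | Elem of I
  | Tens of system I & system I.
Arguments Triv {I}.

Fixpoint hdim (I : Type) (d : I -> nat) (A : system I) : nat :=
  match A with
  | Triv => 1
  | Elem i => d i
  | Tens A B => hdim d A * hdim d B
  end.

Section ResourceTheory.
Variables (R : realType) (I : Type) (d : I -> nat).
Local Notation C := R[i].
Local Notation op A := 'M[C]_(hdim d A).

Record resource_theory := ResourceTheory {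
  free_state : forall A : system I, set (op A);
  free_op : forall A B : system I, set (op A -> op B);
  free_state_is_state : forall A (sigma : op A),
    @free_state A sigma -> is_state sigma;
  free_op_cptp : forall A B (E : op A -> op B), @free_op A B E -> cptp E;
  free_op_state : forall A B (E : op A -> op B) (sigma : op A),
    @free_op A B E -> @free_state A sigma -> @free_state B (E sigma);
  free_op_id : forall A, @free_op A A id;
  free_op_comp : forall A B D (E : op A -> op B) (F : op B -> op D),
    @free_op A B E -> @free_op B D F -> @free_op A D (F \o E);
  free_state_triv : @free_state Triv 1%:M }.

Arguments free_state : clear implicits.
Arguments free_op : clear implicits.

Variable T : resource_theory.

Definition tensor_closed : Prop :=
  (forall A B sigma tau, free_state T A sigma -> free_state T B tau ->
     free_state T (Tens A B) (sigma *t tau)) /\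
  (forall A B A' B' E F, free_op T A B E -> free_op T A' B' F ->
     free_op T (Tens A A') (Tens B B') (tensmap E F)).

(* The factors of a composite carry no preferred order (AX and XA name the    *)
(* same system), so the two conditions below are imposed on either side.      *)
Definition ancilla_preparation : Prop :=
  forall A X sigma, free_state T X sigma ->
    free_op T A (Tens A X) (fun rho => rho *t sigma) /\
    free_op T A (Tens X A) (fun rho => sigma *t rho).

Definition discarding_closed : Prop :=
  forall A X,
    free_op T (Tens A X) A (@ptrace_r R (hdim d A) (hdim d X)) /\
    free_op T (Tens X A) A (@ptrace_l R (hdim d X) (hdim d A)).

Definition convex_free_ops : Prop :=
  forall A B E F (p : R), 0 <= p <= 1 -> free_op T A B E -> free_op T A B F ->
    free_op T A B (fun L => p%:C *: E L + (1 - p)%:C *: F L).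

End ResourceTheory.

Arguments free_state {R I d} _ A _.
Arguments free_op {R I d} _ A B _.

Section Symmetry.
Variables (R : realType) (gT : finGroupType).
Local Notation C := R[i].

Record proj_urep n := ProjURep {
  urep :> gT -> 'M[C]_n;
  urep_unitary : forall g, urep g \is unitarymx;
  urep_mul : forall g h, exists c : C,
    `|c| = 1 /\ urep g *m urep h = c *: urep (g * h)%g }.

Variables (I : Type) (d : I -> nat).
Local Notation op A := 'M[C]_(hdim d A).
Variable U : forall i, proj_urep (d i).

Fixpoint sys_rep (A : system I) (g : gT) : op A :=
  match A return op A with
  | Triv => 1%:M
  | Elem i => U i g
  | Tens A B => sys_rep A g *t sys_rep B g
  end.

Definition sys_act (A : system I) (g : gT) (L : op A) : op A :=
  sys_rep A g *m L *m (sys_rep A g)^t*.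

Definition compatible (T : resource_theory R d) : Prop :=
  (forall g A,
     [set sys_act g sigma | sigma in free_state T A]%classic
       = free_state T A) /\
  (forall g A B,
     [set @sys_act B g \o E \o @sys_act A g^-1%g | E in free_op T A B]%classic
       = free_op T A B).

Definition covariant (K : {set gT}) (A B : system I) (E : op A -> op B) :
    Prop :=
  forall g, g \in K -> E \o @sys_act A g = @sys_act B g \o E.

Definition invariant_state (K : {set gT}) (A : system I) (sigma : op A) :
    Prop :=
  forall g, g \in K -> sys_act g sigma = sigma.

Definition sym_subgroup (A : system I) (rho : op A) : {set gT} :=
  [set g | sys_act g rho == rho].

(* The set G/S of left cosets, with G the whole group gT.                     *)
Definition quo (S : {set gT}) : finType :=
  {x : {set gT} | x \in lcosets S [set: gT]}.

Lemma lcoset_in_lcosets (S : {set gT}) g : (g *: S)%g \in lcosets S [set: gT].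
Proof. by apply/lcosetsP; exists g; rewrite ?inE. Qed.

Definition cl (S : {set gT}) (g : gT) : quo S :=
  Sub (g *: S)%g (lcoset_in_lcosets S g).

Variable S : {set gT}.

Definition is_memory (M : system I) (omega : quo S -> op M) : Prop :=
  [/\ forall x, is_state (omega x),
      forall g h, sys_act g (omega (cl S h)) = omega (cl S (g * h)%g)
    & forall x y, x != y -> omega x *m omega y = 0].

(* X_0 together with the extra symbol is option (quo S), None standing for    *)
(* the extra symbol.                                                          *)
Definition ext_memory (M : system I) (omega : quo S -> op M) (omega_bot : op M)
    (y : option (quo S)) : op M := oapp omega omega_bot y.

Definition free_memory (T : resource_theory R d) (M : system I)
    (omega : quo S -> op M) : Prop :=
  exists omega_bot : op M,
    let om := ext_memory omega omega_bot in
    let P y := supp_proj (om y) in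
    [/\ is_state omega_bot,
        forall x, P None *m P (Some x) = 0,
        \sum_(x : quo S) P (Some x) + P None = 1%:M,
        forall y, free_state T M (om y) /\
          forall A : system I, free_op T A M (fun L : op A => \tr L *: om y)
      & free_op T M M (fun L => \sum_y \tr (P y *m L) *: om y) /\
        forall (B D : system I) (E : option (quo S) -> op B -> op D),
          (forall y, free_op T B D (E y)) ->
          exists2 F : op (Tens M B) -> op (Tens M D),
            free_op T (Tens M B) (Tens M D) F
          & forall y (L : op B), F (om y *t L) = om y *t E y L].

Definition memory_assisted (T : resource_theory R d) (A M : system I)
    (omega : quo S -> op M) (N : quo S -> op A) : Prop :=
  exists2 E : op A -> op M, free_op T A M E
    & forall x, N x = hs_adjoint E (supp_proj (omega x)).

Definition success_prob (A : system I) (rho : op A) (N : quo S -> op A)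
    (g : gT) : R := complex.Re (\tr (N (cl S g) *m sys_act g rho)).

End Symmetry.

(* Main.v *)
From HB Require Import structures.
Require Import Defs.
From mathcomp Require Import all_boot all_order all_fingroup all_algebra.
From mathcomp Require Import mxtens complex.
From mathcomp Require Import boolp classical_sets reals constructive_ereal exp.
Import Order.TTheory GRing.Theory Num.Theory.
Local Open Scope ring_scope.
Local Open Scope complex_scope.

Set Implicit Arguments.
Unset Strict Implicit.
Unset Printing Implicit Defensive.

(* The implications form the cycle (i) -> (ii) -> ... -> (v) -> (i). For      *)
(* (iii) -> (iv), pull the projections Pi_x back along F: by                 *)
(* covariance all success probabilities equal tr(Pi_S F(rho)), and measuring  *)
(* Pi_S turns the bound on Delta into a bound on this number, as f_Delta is   *)
(* strictly increasing. For (v) -> (i), let E0 : A -> M implement the         *)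
(* sub-POVM; apply E0 to A, standardize the memory, apply U_g E U_g^-1 to X   *)
(* conditionally on the memory being in omega_(gS), discard the memory, and   *)
(* average the result over G. On rho (x) chi the outcome is                   *)
(* q E(chi) + (1-q) tau, with q the average success probability; it is the    *)
(* image of a mixture of two orthogonal states, so data processing applies.   *)

(** The parameter of f_Delta is governed by a single weight q. A two-outcome test sends a pair of
    states to the qubit pair that defines [odf] ([trace_ge_of_dist_le]), and conversely a mixture
    that contains tau with weight q is, together with tau, the image of such a qubit pair
    ([dist_le_of_mixture]). Bounds on [Delta] and bounds on success probabilities are therefore
    interchangeable.

    The return to (i) works because an S-covariant operation looks the same from all frames of one
    coset: U_g E U_g^-1 depends only on gS ([covariant_cl_eq]). Learning gS from a copy of U_g(rho)
    thus suffices to apply E in the right frame, and averaging over G ([twirl]) turns the mean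
    success probability into the weight of E(chi), as carried out in [op_conversion_of_avg_success].
    The remaining implications are specializations: a state is a preparation from the trivial
    system, omega_S is itself free and S-invariant, and a mean is at least the minimum. *)

Section PositiveMatrices.
Local Open Scope sesquilinear_scope.
Variable R : realType.
Local Notation C := R[i].

Lemma trmxC_mul m n p (K : 'M[C]_(m, n)) (L : 'M[C]_(n, p)) :
  (K *m L)^t* = L^t* *m K^t*.
Proof. by rewrite trmx_mul map_mxM. Qed.

Lemma trmxC_tens m n p q (K : 'M[C]_(m, n)) (L : 'M[C]_(p, q)) :
  (K *t L)^t* = K^t* *t L^t*.
Proof. by rewrite trmx_tens map_mxT. Qed.

Lemma trmxC1 n : (1%:M : 'M[C]_n)^t* = 1%:M.
Proof. by rewrite trmx1 map_mx1. Qed.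

Lemma trmxCZ m n (a : C) (K : 'M[C]_(m, n)) : (a *: K)^t* = a^* *: K^t*.
Proof. by rewrite linearZ map_mxZ. Qed.

Lemma mxtrace_trmxC n (K : 'M[C]_n) : \tr (K^t*) = (\tr K)^*.
Proof.
by rewrite -map_trmx mxtrace_tr raddf_sum; apply: eq_bigr => i _; rewrite mxE.
Qed.

Lemma psd_hermitian n (M : 'M[C]_n) : psd M -> M^t* = M.
Proof. by case=> /is_hermitianmxP; rewrite expr0 scale1r => <-. Qed.

Lemma psdP n (M : 'M[C]_n) : M^t* = M ->
  (forall v : 'cV[C]_n, 0 <= (v^t* *m M *m v) 0 0) -> psd M.
Proof. by move=> hM pM; split=> //; apply/is_hermitianmxP; rewrite expr0 scale1r. Qed.

Lemma psd_conj m n (K : 'M[C]_(m, n)) (M : 'M[C]_n) :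
  psd M -> psd (K *m M *m K^t*).
Proof.
move=> pM; apply: psdP => [|v].
  by rewrite !trmxC_mul trmxCK (psd_hermitian pM) !mulmxA.
have := pM.2 (K^t* *m v); rewrite trmxC_mul trmxCK.
by rewrite !mulmxA.
Qed.

Lemma psd0 n : psd (0 : 'M[C]_n).
Proof.
by apply: psdP => [|v]; rewrite ?trmx0 ?map_mx0 // mulmx0 mul0mx mxE.
Qed.

Lemma psdD n (M N : 'M[C]_n) : psd M -> psd N -> psd (M + N).
Proof.
move=> pM pN; apply: psdP => [|v].
  by rewrite linearD map_mxD /= (psd_hermitian pM) (psd_hermitian pN).
by rewrite mulmxDr mulmxDl mxE addr_ge0 ?pM.2 ?pN.2.
Qed.

Lemma psd_sum n (J : Type) (r : seq J) (P : pred J) (F : J -> 'M[C]_n) :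
  (forall j, P j -> psd (F j)) -> psd (\sum_(j <- r | P j) F j).
Proof. by move=> pF; elim/big_ind: _; [exact: psd0|exact: psdD|exact: pF]. Qed.

Lemma psdZ n (a : C) (M : 'M[C]_n) : 0 <= a -> psd M -> psd (a *: M).
Proof.
move=> a0 pM; apply: psdP => [|v].
  by rewrite trmxCZ (psd_hermitian pM) geC0_conj.
by rewrite -scalemxAr -scalemxAl mxE mulr_ge0 ?pM.2.
Qed.

Lemma psd1 n : psd (1%:M : 'M[C]_n).
Proof.
apply: psdP => [|v]; first exact: trmxC1.
rewrite mulmx1 mxE sumr_ge0 // => i _.
by rewrite !mxE mulrC mul_conjC_ge0.
Qed.

Lemma psd_gram m n (K : 'M[C]_(m, n)) : psd (K *m K^t*).
Proof. by rewrite -[K in K *m _]mulmx1; exact: psd_conj (psd1 n). Qed.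

Lemma psd_proj n (P : 'M[C]_n) : P^t* = P -> P *m P = P -> psd P.
Proof. by move=> hP pP; have := psd_gram P; rewrite hP pP. Qed.

(** Diagonalize M by a unitary and take square roots of the eigenvalues, which are values of the
    quadratic form of M. The later positivity arguments reduce to Gram matrices through this
    factorization. *)
Lemma psd_factor n (M : 'M[C]_n) : psd M -> exists K : 'M[C]_n, M = K *m K^t*.
Proof.
move=> pM; have /hermitian_normalmx/orthomx_spectralP defM := pM.1.
set P := spectralmx M in defM; set D := spectral_diag M in defM.
have uP : P \is unitarymx by exact: spectral_unitarymx.
clearbody P D; have PP : P *m P^t* = 1%:M by exact/unitarymxP.
have D0 i : 0 <= D 0 i.
  have -> : D 0 i = (P *m M *m P^t*) i i.
    rewrite defM invmx_unitary // !mulmxA PP mul1mx -mulmxA PP mulmx1.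
    by rewrite mxE eqxx mulr1n.
  have := pM.2 ((row i P)^t*); rewrite trmxCK -row_mul => h.
  suff -> : (P *m M *m P^t*) i i = (row i (P *m M) *m (row i P)^t*) 0 0 by [].
  by rewrite !mxE; apply: eq_bigr => j _; rewrite !mxE.
pose Q := diag_mx (map_mx sqrtC D).
have QQ : diag_mx D = Q *m Q^t*.
  rewrite tr_diag_mx map_diag_mx mulmx_diag; congr diag_mx.
  apply/rowP => i; rewrite !mxE.
  have s0 : 0 <= sqrtC (D 0 i) by rewrite sqrtC_ge0.
  by rewrite [X in _ = _ * X](geC0_conj s0) -expr2 sqrtCK.
exists (P^t* *m Q); rewrite defM (invmx_unitary uP) QQ trmxC_mul trmxCK.
by rewrite !mulmxA.
Qed.

Lemma mxtrace_gram m n (K : 'M[C]_(m, n)) :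
  \tr (K *m K^t*) = \sum_i \sum_j K i j * (K i j)^*.
Proof.
apply: eq_bigr => i _; rewrite mxE; apply: eq_bigr => j _.
by rewrite !mxE.
Qed.

(** With Gram factors K of M and L of N, cyclicity makes the trace the squared Hilbert-Schmidt norm
    of L^t* K. *)
Lemma psd_trace_mul n (M N : 'M[C]_n) : psd M -> psd N -> 0 <= \tr (M *m N).
Proof.
move=> /psd_factor[K ->] /psd_factor[L ->].
have -> : \tr (K *m K^t* *m (L *m L^t*)) = \tr (L^t* *m K *m (L^t* *m K)^t*).
  by rewrite trmxC_mul trmxCK mulmxA mxtrace_mulC !mulmxA.
rewrite mxtrace_gram; apply: sumr_ge0 => i _; apply: sumr_ge0 => j _.
exact: mul_conjC_ge0.
Qed.

Lemma psd_trace_ge0 n (M : 'M[C]_n) : psd M -> 0 <= \tr M.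
Proof. by move=> pM; have := psd_trace_mul (psd1 n) pM; rewrite mul1mx. Qed.

Lemma psd_trace_eq0 n (M : 'M[C]_n) : psd M -> \tr M = 0 -> M = 0.
Proof.
move=> /psd_factor[K ->]; rewrite mxtrace_gram => /eqP.
rewrite psumr_eq0 => [/allP h|i _]; last first.
  by apply: sumr_ge0 => j _; exact: mul_conjC_ge0.
suff -> : K = 0 by rewrite mul0mx.
apply/matrixP => i j; rewrite mxE.
have := h i (mem_index_enum _); rewrite /= psumr_eq0 => [/allP h'|l _]; last first.
  exact: mul_conjC_ge0.
by have := h' j (mem_index_enum _); rewrite /= mul_conjC_eq0 => /eqP.
Qed.

End PositiveMatrices.

(** * Linear and completely positive maps, channels, and Hilbert-Schmidt adjoints *)

Section Channels.
Local Open Scope sesquilinear_scope.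
Variable R : realType.
Local Notation C := R[i].

(** Channels are plain functions with a proof of [linear]; packing them locally gives access to the
    theory of bundled linear maps. *)
Lemma linear_sum_fun m n (E : 'M[C]_m -> 'M[C]_n) (J : Type) (r : seq J)
    (P : pred J) (F : J -> 'M[C]_m) : linear E ->
  E (\sum_(j <- r | P j) F j) = \sum_(j <- r | P j) E (F j).
Proof.
move=> linE.
pose E' := HB.pack_for {linear 'M[C]_m -> 'M[C]_n} E
  (GRing.isLinear.Build _ _ _ _ _ linE).
exact: (linear_sum E').
Qed.

Lemma linear_scale_fun m n (E : 'M[C]_m -> 'M[C]_n) a L : linear E ->
  E (a *: L) = a *: E L.
Proof.
move=> linE.
pose E' := HB.pack_for {linear 'M[C]_m -> 'M[C]_n} E
  (GRing.isLinear.Build _ _ _ _ _ linE).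
exact: (linearZ_LR E').
Qed.

Lemma tensmx_sumr m n p q (K : 'M[C]_(m, n)) (J : Type) (r : seq J)
    (P : pred J) (F : J -> 'M[C]_(p, q)) :
  K *t (\sum_(j <- r | P j) F j) = \sum_(j <- r | P j) (K *t F j).
Proof.
apply/matrixP => a b; case: (mxtens_indexP a) => a1 a2.
case: (mxtens_indexP b) => b1 b2; rewrite tensmxE !summxE mulr_sumr.
by apply: eq_bigr => j _; rewrite tensmxE.
Qed.

Lemma tensmx_suml m n p q (K : 'M[C]_(m, n)) (J : Type) (r : seq J)
    (P : pred J) (F : J -> 'M[C]_(p, q)) :
  (\sum_(j <- r | P j) F j) *t K = \sum_(j <- r | P j) (F j *t K).
Proof.
apply/matrixP => a b; case: (mxtens_indexP a) => a1 a2.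
case: (mxtens_indexP b) => b1 b2; rewrite tensmxE !summxE mulr_suml.
by apply: eq_bigr => j _; rewrite tensmxE.
Qed.

Lemma tensmxZl m n p q a (K : 'M[C]_(m, n)) (L : 'M[C]_(p, q)) :
  (a *: K) *t L = a *: (K *t L).
Proof.
apply/matrixP => i j; case: (mxtens_indexP i) => i1 i2.
by case: (mxtens_indexP j) => j1 j2; rewrite [RHS]mxE !tensmxE mxE mulrA.
Qed.

Lemma tensmap_id m n (X : 'M[C]_(m * n)) :
  tensmap (@id 'M[C]_m) (@id 'M[C]_n) X = X.
Proof.
apply/matrixP => a b; case: (mxtens_indexP a) => a1 a2.
case: (mxtens_indexP b) => b1 b2; rewrite /tensmap.
have termE i j k l :
    (X (mxtens_index (i, k)) (mxtens_index (j, l)) *: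
       (id (delta_mx i j : 'M[C]_m) *t id (delta_mx k l : 'M[C]_n)))
      (mxtens_index (a1, a2)) (mxtens_index (b1, b2)) =
    X (mxtens_index (i, k)) (mxtens_index (j, l)) *
      (((a1 == i) && (b1 == j))%:R * ((a2 == k) && (b2 == l))%:R).
  by rewrite mxE tensmxE !mxE.
rewrite summxE (bigD1 a1) //= summxE (bigD1 b1) //= summxE (bigD1 a2) //=.
rewrite summxE (bigD1 b2) //= termE !eqxx !mulr1.
rewrite !big1 ?addr0 // => [i ia|i ib|i ia|i ib].
- rewrite summxE big1 // => j _; rewrite summxE big1 // => k _.
  rewrite summxE big1 // => l _.
  by rewrite termE [a1 == i]eq_sym (negbTE ia) mul0r mulr0.
- rewrite summxE big1 // => k _; rewrite summxE big1 // => l _.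
  by rewrite termE [b1 == i]eq_sym (negbTE ib) andbF mul0r mulr0.
- rewrite summxE big1 // => l _.
  by rewrite termE [a2 == i]eq_sym (negbTE ia) !mulr0.
- rewrite termE [b2 == i]eq_sym (negbTE ib) andbF mulr0 mulr0 //.
Qed.

(** Gives any linear map the shape of the definition of [tensmap], so that the two can be compared
    term by term on product matrix units. *)
Lemma linear_tens_expand m1 m2 n (E : 'M[C]_(m1 * m2) -> 'M[C]_n) (X : 'M[C]_(m1 * m2)) :
  linear E -> E X = \sum_(i < m1) \sum_(j < m1) \sum_(k < m2) \sum_(l < m2)
    X (mxtens_index (i, k)) (mxtens_index (j, l)) *:
      E (delta_mx i j *t delta_mx k l).
Proof.
move=> linE; rewrite -{1}(tensmap_id X) /tensmap.
rewrite linear_sum_fun //; apply: eq_bigr => i _.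
rewrite linear_sum_fun //; apply: eq_bigr => j _.
rewrite linear_sum_fun //; apply: eq_bigr => k _.
rewrite linear_sum_fun //; apply: eq_bigr => l _.
by rewrite linear_scale_fun.
Qed.

Lemma eq_completely_positive m n (E F : 'M[C]_m -> 'M[C]_n) : E =1 F ->
  completely_positive E -> completely_positive F.
Proof.
move=> EF cpE k X /cpE; congr psd; apply: eq_bigr => i _; apply: eq_bigr => j _.
by apply: eq_bigr => a _; apply: eq_bigr => b _; rewrite EF.
Qed.

(** Tensoring with the identity turns conjugation by K into conjugation by 1 (x) K. This is the case
    of a single Kraus operator, from which the measure-and-prepare maps are assembled. *)
Lemma completely_positive_conj m n (K : 'M[C]_(n, m)) :
  completely_positive (fun L : 'M[C]_m => K *m L *m K^t*).
Proof.
move=> k X pX; set J : 'M[C]_(k * n, k * m) := 1%:M *t K.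
suff -> : tensmap id (fun L => K *m L *m K^t*) X = J *m X *m J^t*.
  exact: psd_conj.
rewrite (@linear_tens_expand k m _ (fun X => J *m X *m J^t*)); last first.
  by move=> a u v; rewrite mulmxDr mulmxDl -scalemxAr -scalemxAl.
rewrite /tensmap; do 4 (apply: eq_bigr => ? _); congr (_ *: _).
by rewrite /J trmxC_tens !tensmx_mul trmxC1 mul1mx mulmx1.
Qed.

Lemma completely_positive_sum m n (J : Type) (r : seq J) (P : pred J)
    (E : J -> 'M[C]_m -> 'M[C]_n) :
  (forall j, P j -> completely_positive (E j)) ->
  completely_positive (fun L => \sum_(j <- r | P j) E j L).
Proof.
move=> cpE k X pX.
suff -> : tensmap id (fun L => \sum_(j <- r | P j) E j L) X =
    \sum_(j <- r | P j) tensmap id (E j) X.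
  by apply: psd_sum => j Pj; exact: cpE.
rewrite /tensmap.
rewrite [RHS]exchange_big /=; apply: eq_bigr => i1 _.
rewrite [RHS]exchange_big /=; apply: eq_bigr => i2 _.
rewrite [RHS]exchange_big /=; apply: eq_bigr => i3 _.
rewrite [RHS]exchange_big /=; apply: eq_bigr => i4 _.
by rewrite tensmx_sumr scaler_sumr.
Qed.

Lemma completely_positive_add m n (E F : 'M[C]_m -> 'M[C]_n) :
  completely_positive E -> completely_positive F ->
  completely_positive (fun L => E L + F L).
Proof.
move=> cpE cpF; have := @completely_positive_sum m n bool
  (index_enum bool) xpredT (fun b => if b then E else F).
move=> /(_ _)/eq_completely_positive; apply => [L|[] //].
by rewrite big_bool.
Qed.

(** Complete positivity with a one-dimensional ancilla, whose tensor factor has to be removed by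
    hand. *)
Lemma cptp_psd m n (E : 'M[C]_m -> 'M[C]_n) X : cptp E -> psd X -> psd (E X).
Proof.
case=> linE cpE _ /psd_factor[K ->].
(* Z |-> J Z J^* strips the tensor factor 1%:M : 'M_1. *)
pose J : 'M[C]_(n, 1 * n) := \matrix_(i, j) (j == mxtens_index (ord0, i))%:R.
have := cpE 1%N ((1%:M *t K) *m (1%:M *t K)^t*) (psd_gram _).
rewrite trmxC_tens trmxC1 tensmx_mul mulmx1 tensmap_tens // => pE.
have := psd_conj J pE; congr psd; set Y := E _.
have JE p (Z : 'M[C]_(1 * n, p)) i j : (J *m Z) i j = Z (mxtens_index (ord0, i)) j.
  rewrite mxE (bigD1 (mxtens_index (ord0, i))) //= mxE eqxx mul1r big1 ?addr0 //.
  by move=> l li; rewrite mxE (negbTE li) mul0r.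
apply/matrixP => i j; rewrite -mulmxA JE.
rewrite -[_ *m J^t*]trmxCK mxE mxE trmxC_mul trmxCK JE mxE mxE tensmxE !mxE.
by rewrite conjCK eqxx mul1r.
Qed.

Lemma cptp_state m n (E : 'M[C]_m -> 'M[C]_n) X :
  cptp E -> is_state X -> is_state (E X).
Proof.
by move=> cE [pX tX]; split; [exact: cptp_psd|case: cE => _ _ ->].
Qed.

Lemma completely_positive_measure_prepare m n (P : 'M[C]_m) (tau : 'M[C]_n) :
  psd P -> psd tau -> completely_positive (fun L => \tr (P *m L) *: tau).
Proof.
(* With P = A A^* and tau = B B^*, the Kraus operators are b_j a_i^*. *)
move=> /psd_factor[A ->] /psd_factor[B ->].
have cp i j : completely_positive
    (fun L => (col j B *m (col i A)^t*) *m L *m (col j B *m (col i A)^t*)^t*).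
  exact: completely_positive_conj.
have := completely_positive_sum (index_enum _) (P := xpredT) (fun i _ =>
  completely_positive_sum (index_enum _) (P := xpredT) (fun j _ => cp i j)).
apply: eq_completely_positive => L /=.
have -> : B *m B^t* = \sum_j col j B *m (col j B)^t*.
  apply/matrixP => a b; rewrite summxE mxE; apply: eq_bigr => j _.
  by rewrite [RHS]mxE big_ord1 !mxE.
have -> : \tr (A *m A^t* *m L) = \sum_i ((col i A)^t* *m L *m col i A) 0 0.
  rewrite -mulmxA mxtrace_mulC; apply: eq_bigr => i _.
  rewrite !mxE; apply: eq_bigr => j _; rewrite !mxE.
  by congr (_ * _); apply: eq_bigr => l _; rewrite !mxE.
rewrite scaler_suml; apply: eq_bigr => i _.
rewrite scaler_sumr; apply: eq_bigr => j _.
rewrite trmxC_mul trmxCK.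
transitivity (col j B *m ((col i A)^t* *m L *m col i A) *m (col j B)^t*).
  by rewrite !mulmxA.
by rewrite {1}[_ *m L *m _]mx11_scalar mul_mx_scalar scalemxAl.
Qed.

(** Used in both directions: from a system to a qubit, to test P, and from a qubit to a system, to
    realize a prescribed mixture. *)
Lemma cptp_measure_prepare m n (P : 'M[C]_m) (tau0 tau1 : 'M[C]_n) :
  psd P -> psd (1%:M - P) -> is_state tau0 -> is_state tau1 ->
  cptp (fun L => \tr (P *m L) *: tau0 + \tr ((1%:M - P) *m L) *: tau1).
Proof.
move=> pP pQ [p0 t0] [p1 t1]; split.
- move=> a L L'; rewrite !mulmxDr -!scalemxAr !mxtraceD !mxtraceZ.
  by rewrite !scalerDl scalerDr !scalerA addrACA.
- by apply: completely_positive_add; exact: completely_positive_measure_prepare.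
- move=> L; rewrite mxtraceD !mxtraceZ t0 t1 !mulr1.
  by rewrite mulmxBl mul1mx raddfB /= addrC subrK.
Qed.

Lemma ptrace_l_tens m n (K : 'M[C]_m) (L : 'M[C]_n) :
  ptrace_l (K *t L) = \tr K *: L.
Proof.
apply/matrixP => i j; rewrite !mxE mulr_suml; apply: eq_bigr => k _.
by rewrite tensmxE.
Qed.

(** For positive L both L and E L are Hermitian, which removes the adjoints from the defining
    identity of [hs_adjoint]. *)
Lemma hs_adjoint_trace m n (E : 'M[C]_m -> 'M[C]_n) (P : 'M[C]_n) (L : 'M[C]_m) :
  cptp E -> psd L -> \tr (hs_adjoint E P *m L) = \tr (P *m E L).
Proof.
move=> cE pL; have linE : linear E by case: cE.
have := hs_adjointP L P linE; rewrite !psd_hermitian //; last exact: cptp_psd.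
by rewrite mxtrace_mulC [in RHS]mxtrace_mulC => ->.
Qed.

Lemma cptp_delta_trmxC m n (E : 'M[C]_m -> 'M[C]_n) (i j : 'I_m) :
  completely_positive E -> (E (delta_mx i j))^t* = E (delta_mx j i).
Proof.
(* The Choi matrix of E is hermitian. *)
move=> cpE.
(* The unnormalized maximally entangled vector; the blocks of the image of its projector are the
   E(|k><l|). *)
pose v : 'cV[C]_(m * m) :=
  \col_p ((mxtens_unindex p).1 == (mxtens_unindex p).2)%:R.
have vE k l k' l' : (v *m v^t*) (mxtens_index (k, l)) (mxtens_index (k', l')) =
    ((k == l) && (k' == l'))%:R.
  by rewrite mxE big_ord1 !mxE !mxtens_indexK /= conjC_nat -natrM mulnb.
have /psd_hermitian hE := cpE m _ (psd_gram v).
have choiE k l a b : tensmap id E (v *m v^t*) (mxtens_index (k, a))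
    (mxtens_index (l, b)) = E (delta_mx k l) a b.
  rewrite /tensmap summxE (bigD1 k) //= summxE (bigD1 l) //=.
  rewrite summxE (bigD1 k) //= summxE (bigD1 l) //=.
  rewrite mxE tensmxE vE !eqxx !mxE !eqxx /= !mul1r.
  rewrite !big1 ?addr0 // => [k' kk|l' ll|k' kk|l' ll].
  - rewrite summxE big1 // => l' _; rewrite summxE big1 // => k2 _.
    rewrite summxE big1 // => l2 _; rewrite mxE tensmxE !mxE.
    by rewrite [k == k']eq_sym (negbTE kk) /= mul0r mulr0.
  - rewrite summxE big1 // => k2 _; rewrite summxE big1 // => l2 _.
    rewrite mxE tensmxE !mxE.
    by rewrite [l == l']eq_sym (negbTE ll) andbF mul0r mulr0.
  - rewrite summxE big1 // => l2 _; rewrite mxE vE.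
    by rewrite [k == k']eq_sym (negbTE kk) mul0r.
  - by rewrite mxE vE [l == l']eq_sym (negbTE ll) andbF mul0r.
apply/matrixP => a b; rewrite -choiE -[in RHS]hE !mxE; congr (_^*).
by rewrite choiE.
Qed.

Lemma hs_adjoint_psd m n (E : 'M[C]_m -> 'M[C]_n) (P : 'M[C]_n) :
  cptp E -> psd P -> psd (hs_adjoint E P).
Proof.
move=> cE pP; apply: psdP => [|v].
  apply/matrixP => i j; rewrite !mxE.
  apply: (etrans (esym (mxtrace_trmxC _))); rewrite trmxC_mul trmxCK.
  rewrite psd_hermitian // mxtrace_mulC cptp_delta_trmxC //; by case: cE.
have pv := psd_gram v.
suff -> : (v^t* *m hs_adjoint E P *m v) 0 0 = \tr (hs_adjoint E P *m (v *m v^t*)).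
  by rewrite (hs_adjoint_trace P cE pv); exact: psd_trace_mul pP (cptp_psd cE pv).
by rewrite mulmxA mxtrace_mulC mulmxA /mxtrace big_ord1.
Qed.

Lemma hs_adjoint1 m n (E : 'M[C]_m -> 'M[C]_n) : cptp E ->
  hs_adjoint E 1%:M = 1%:M.
Proof.
case=> linE _ trE; apply/matrixP => i j; rewrite !mxE mulmx1.
rewrite mxtrace_trmxC trE /mxtrace (bigD1 i) //= mxE eqxx /=.
rewrite big1 ?addr0 => [|k ki]; first by rewrite rmorph_nat.
by rewrite mxE (negbTE ki).
Qed.

Lemma hs_adjointB m n (E : 'M[C]_m -> 'M[C]_n) (P Q : 'M[C]_n) :
  hs_adjoint E (P - Q) = hs_adjoint E P - hs_adjoint E Q.
Proof. by apply/matrixP => i j; rewrite !mxE mulmxBr raddfB. Qed.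

Lemma hs_adjoint_sum m n (E : 'M[C]_m -> 'M[C]_n) (J : Type) (r : seq J)
    (P : pred J) (F : J -> 'M[C]_n) :
  hs_adjoint E (\sum_(j <- r | P j) F j) = \sum_(j <- r | P j) hs_adjoint E (F j).
Proof.
apply/matrixP => i j; rewrite mxE mulmx_sumr raddf_sum summxE /=.
by apply: eq_bigr => k _; rewrite mxE.
Qed.

End Channels.

(** * Support projections and their behaviour under unitaries *)

Section SupportProjection.
Local Open Scope sesquilinear_scope.
Variable R : realType.
Local Notation C := R[i].

Lemma supp_proj_psd n (M : 'M[C]_n) : psd (supp_proj M).
Proof. by case: (supp_projP M) => hP pP _; exact: psd_proj. Qed.

Lemma supp_proj_trace n (M : 'M[C]_n) : psd M -> \tr (supp_proj M *m M) = \tr M.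
Proof.
move=> pM; case: (supp_projP M) => _ pP eP.
have /submxP[D defM] : (M <= supp_proj M)%MS by rewrite eP.
by rewrite mxtrace_mulC {1}defM -mulmxA pP -defM.
Qed.

(** Equal row spaces give PQ = P and QP = Q; the adjoint of the second equation reads PQ = Q. *)
Lemma orthogonal_proj_inj n (P Q : 'M[C]_n) :
  P^t* = P -> Q^t* = Q -> P *m P = P -> Q *m Q = Q ->
  (P :=: Q)%MS -> P = Q.
Proof.
move=> hP hQ pP pQ ePQ.
have /submxP[D defP] : (P <= Q)%MS by rewrite ePQ.
have /submxP[E defQ] : (Q <= P)%MS by rewrite ePQ.
have PQ : P *m Q = P by rewrite defP -mulmxA pQ.
have QP : Q *m P = Q by rewrite defQ -mulmxA pP.
by have := congr1 (fun X : 'M[C]_n => X^t*) QP; rewrite /= trmxC_mul hP hQ PQ.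
Qed.

Lemma supp_proj_conj n (V M : 'M[C]_n) : V \is unitarymx ->
  supp_proj (V *m M *m V^t*) = V *m supp_proj M *m V^t*.
Proof.
move=> uV; have VV : V^t* *m V = 1%:M.
  by rewrite -invmx_unitary // mulVmx // unitarymx_unit.
move: (supp_projP M) (supp_projP (V *m M *m V^t*)).
move: (supp_proj M) (supp_proj (V *m M *m V^t*)) => P Q /= [hP pP eP] [hQ pQ eQ].
have mulV (D L : 'M[C]_n) :
    V *m (D *m L) *m V^t* = V *m D *m V^t* *m (V *m L *m V^t*).
  by rewrite !mulmxA -[V *m D *m V^t* *m V]mulmxA VV mulmx1.
apply: orthogonal_proj_inj => //.
- by rewrite !trmxC_mul trmxCK hP mulmxA.
- by rewrite -mulV pP.
apply: eqmx_trans eQ _; apply/eqmxP/andP; split.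
  have /submxP[D defM] : (M <= P)%MS by rewrite eP.
  by rewrite {1}defM mulV submxMl.
have /submxP[D defP] : (P <= M)%MS by rewrite eP.
by rewrite defP mulV submxMl.
Qed.

End SupportProjection.

(** * Translating between [Delta] and weights of mixtures *)

Section OrthogonalDistinguishability.
Local Open Scope sesquilinear_scope.
Variable R : realType.
Local Notation C := R[i].

Lemma delta_mx_is_state n (i : 'I_n) : is_state (delta_mx i i : 'M[C]_n).
Proof.
have -> : delta_mx i i = delta_mx i 0 *m (delta_mx i 0 : 'cV[C]_n)^t*.
  by rewrite trmx_delta map_delta_mx mul_delta_mx.
split; first exact: psd_gram.
rewrite mxtrace_mulC trmx_delta map_delta_mx mul_delta_mx.
by rewrite /mxtrace big_ord1 mxE !eqxx.
Qed.

Lemma psd_trace_real n (P L : 'M[C]_n) : psd P -> psd L ->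
  \tr (P *m L) = (complex.Re (\tr (P *m L)))%:C.
Proof.
move=> pP pL; have := psd_trace_mul pP pL; case: (\tr _) => a b.
by rewrite lecE /= => /andP[/eqP -> _].
Qed.

Variables (Delta : distinguishability_measure R).

Lemma odf_ln (q : R) : 0 < q ->
  odf Delta (- ln q)%:E =
  Delta 2%N (delta_mx 0 0) (q%:C *: delta_mx 0 0 + (1 - q)%:C *: delta_mx 1 1).
Proof. by move=> q0; rewrite /odf /= opprK lnK. Qed.

(** Weight q = 0 corresponds to x = +oo and is out of reach of [odf_ln]. *)
Lemma odf_pinfty : odf Delta +oo%E =
  Delta 2%N (delta_mx 0 0) (0%:C *: delta_mx 0 0 + (1 - 0)%:C *: delta_mx 1 1).
Proof. by []. Qed.

Hypothesis Delta_incr : strictly_increasing_odf Delta.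
Variable eps : R.
Hypothesis eps_range : 0 <= eps < 1.

Let eps0 : 0 < 1 - eps. Proof. by case/andP: eps_range; rewrite subr_gt0. Qed.

Let ln_eps_ge0 : 0 <= - ln (1 - eps).
Proof. by rewrite oppr_ge0 ln_le0 // gerBl; case/andP: eps_range. Qed.

(** Measure P and record the outcome in a qubit: omega becomes |0><0|, and sigma becomes the mixture
    with weight q = tr(P sigma). If q were below 1 - eps, strict monotonicity of f_Delta would
    contradict data processing. *)
Lemma trace_ge_of_dist_le n (omega sigma P : 'M[C]_n) :
  is_state omega -> is_state sigma -> psd P -> psd (1%:M - P) ->
  \tr (P *m omega) = 1 ->
  (Delta _ omega sigma <= odf Delta (- ln (1 - eps))%:E)%E ->
  1 - eps <= complex.Re (\tr (P *m sigma)).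
Proof.
move=> so ss pP pQ tP dle.
set q := complex.Re _; have qE : \tr (P *m sigma) = q%:C.
  exact: psd_trace_real pP ss.1.
have q0 : 0 <= q by rewrite -lecR -qE; exact: psd_trace_mul pP ss.1.
have := cptp_measure_prepare pP pQ (@delta_mx_is_state 2 0) (@delta_mx_is_state 2 1).
move=> /(dist_data_processing Delta) /(_ so ss) /=.
rewrite !mulmxBl !mul1mx !raddfB /= tP qE so.2 ss.2 subrr scale0r addr0 scale1r.
move=> /le_trans /(_ dle); rewrite leNgt => dle'.
have q1E : 1 - q%:C = (1 - q)%:C by rewrite rmorphB rmorph1.
rewrite leNgt; apply: contra dle' => qlt; rewrite q1E.
have [q00|qn0] := eqVneq q 0; first by rewrite q00 -odf_pinfty Delta_incr // ltry.
have q_gt0 : 0 < q by rewrite lt_neqAle eq_sym qn0.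
rewrite -(odf_ln q_gt0); apply: Delta_incr; first by rewrite lee_fin.
by rewrite lte_fin ltrN2 ltr_ln ?posrE.
Qed.

(** Preparing tau on |0> and the normalized rest on |1> maps the defining qubit pair of [odf] to the
    pair at hand; data processing bounds [Delta] by f_Delta(-ln q), and monotonicity does the
    rest. *)
Lemma dist_le_of_mixture n (tau rest : 'M[C]_n) (q : R) :
  is_state tau -> psd rest -> \tr (q%:C *: tau + rest) = 1 -> 1 - eps <= q ->
  (Delta _ tau (q%:C *: tau + rest)%R <= odf Delta (- ln (1 - eps))%:E)%E.
Proof.
move=> st pr tr1 leq.
have q0 : 0 < q by exact: lt_le_trans leq.
have trest : \tr rest = (1 - q)%:C.
  by rewrite rmorphB rmorph1 -tr1 mxtraceD mxtraceZ st.2 mulr1 addrC addKr.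
have q1 : q <= 1 by have := psd_trace_ge0 pr; rewrite trest lecR subr_ge0.
have [tau1 st1 ->] : exists2 tau1 : 'M[C]_n,
    is_state tau1 & rest = (1 - q)%:C *: tau1.
  (* At q = 1 the rest is positive of trace zero, hence zero, and cannot be normalized; tau serves
     as an arbitrary filler of weight 0. *)
  have [q1E|qn1] := eqVneq q 1.
    exists tau => //; rewrite q1E subrr scale0r.
    by apply: psd_trace_eq0 => //; rewrite trest q1E subrr.
  have nz : (1 - q)%:C != 0 :> C.
    by rewrite eq_complex /= eqxx andbT subr_eq0 eq_sym.
  exists (((1 - q)%:C)^-1 *: rest); last by rewrite scalerA mulfV // scale1r.
  split; last by rewrite mxtraceZ trest mulVf.
  by apply: psdZ => //; rewrite invr_ge0 lecR subr_ge0.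
apply: (@le_trans _ _ (odf Delta (- ln q)%:E)).
  have pP : psd (delta_mx 0 0 : 'M[C]_2) := (delta_mx_is_state _).1.
  have QE : 1%:M - delta_mx 0 0 = delta_mx 1 1 :> 'M[C]_2.
    apply/matrixP => i j; rewrite !mxE.
    by case: i => [[|[|//]] ?]; case: j => [[|[|//]] ?]; rewrite ?subrr ?subr0.
  have pQ : psd (1%:M - delta_mx 0 0 : 'M[C]_2).
    by rewrite QE; exact: (delta_mx_is_state _).1.
  have cE := cptp_measure_prepare pP pQ st st1.
  have smix : is_state (q%:C *: delta_mx 0 0 + (1 - q)%:C *: delta_mx 1 1 : 'M[C]_2).
    have qC : 0 <= q%:C :> C by rewrite lecR ltW.
    have q1C : 0 <= (1 - q)%:C :> C by rewrite lecR subr_ge0.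
    split; first exact: psdD (psdZ qC (delta_mx_is_state _).1)
                             (psdZ q1C (delta_mx_is_state _).1).
    rewrite mxtraceD !mxtraceZ !(delta_mx_is_state _).2 !mulr1.
    by rewrite -rmorphD addrC subrK.
  have := dist_data_processing Delta cE (@delta_mx_is_state 2 0) smix.
  rewrite QE odf_ln // !mulmxDr -!scalemxAr !mul_delta_mx.
  rewrite !mul_delta_mx_0 // !scaler0 addr0 add0r !mxtraceZ mxtrace0.
  by rewrite !(delta_mx_is_state _).2 !mulr1 !scale1r scale0r addr0.
have [->//|ne] := eqVneq (1 - eps) q.
apply/ltW/Delta_incr; first by rewrite lee_fin oppr_ge0 ln_le0.
by rewrite lte_fin ltrN2 ltr_ln ?posrE // lt_neqAle ne.
Qed.

End OrthogonalDistinguishability.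

(** * The group action on operators, cosets of the stabilizer, and twirling *)

Section Symmetries.
Local Open Scope sesquilinear_scope.
Variables (R : realType) (gT : finGroupType) (I : Type) (d : I -> nat).
Variable U : forall i : I, proj_urep R gT (d i).
Local Notation C := R[i].
Local Notation op A := 'M[C]_(hdim d A).
Local Notation act := (sys_act U).

Lemma tensmx11 m n : (1%:M : 'M[C]_m) *t (1%:M : 'M[C]_n) = 1%:M.
Proof.
apply/matrixP => i j; case: (mxtens_indexP i) => i1 i2.
case: (mxtens_indexP j) => j1 j2; rewrite tensmxE !mxE.
by rewrite (can_eq (@mxtens_indexK _ _)) xpair_eqE -natrM mulnb.
Qed.

Lemma sys_rep_unitary A g : sys_rep U A g \is unitarymx.
Proof.
elim: A => [|i|A IHA B IHB] /=; last 1 first.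
- apply/unitarymxP; rewrite trmxC_tens tensmx_mul.
  by rewrite (unitarymxP IHA) (unitarymxP IHB) tensmx11.
- by apply/unitarymxP; rewrite trmxC1 mulmx1.
- exact: urep_unitary.
Qed.

Lemma sys_rep_mul A g h : exists c : C, `|c| = 1 /\
  sys_rep U A g *m sys_rep U A h = c *: sys_rep U A (g * h)%g.
Proof.
elim: A => [|i|A [a [a1 IHA]] B [b [b1 IHB]]] /=.
- by exists 1; rewrite normr1 mulmx1 scale1r.
- exact: urep_mul.
- exists (a * b); split; first by rewrite normrM a1 b1 mulr1.
  rewrite tensmx_mul IHA IHB; apply/matrixP => i j.
  case: (mxtens_indexP i) => i1 i2; case: (mxtens_indexP j) => j1 j2.
  by rewrite [RHS]mxE !tensmxE !mxE mulrACA.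
Qed.

Lemma sys_act_linear A g : linear (@sys_act _ _ _ _ U A g).
Proof. by move=> a L L'; rewrite /sys_act mulmxDr mulmxDl -scalemxAr -scalemxAl. Qed.

Lemma sys_actZ A g a (L : op A) : act g (a *: L) = a *: act g L.
Proof. exact: linear_scale_fun (@sys_act_linear A g). Qed.

Lemma sys_act_sum A g (J : Type) (r : seq J) (P : pred J) (F : J -> op A) :
  act g (\sum_(j <- r | P j) F j) = \sum_(j <- r | P j) act g (F j).
Proof. exact: linear_sum_fun (@sys_act_linear A g). Qed.

Lemma sys_act_psd A g (L : op A) : psd L -> psd (act g L).
Proof. exact: psd_conj. Qed.

Lemma sys_act_trace A g (L : op A) : \tr (act g L) = \tr L.
Proof.
rewrite /sys_act -mulmxA mxtrace_mulC -mulmxA.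
have uV := sys_rep_unitary A g.
by rewrite -invmx_unitary // mulVmx ?mulmx1 // unitarymx_unit.
Qed.

Lemma sys_act_state A g (L : op A) : is_state L -> is_state (act g L).
Proof. by case=> pL tL; split; [exact: sys_act_psd|rewrite sys_act_trace]. Qed.

Lemma sys_actM A g h (L : op A) : act g (act h L) = act (g * h)%g L.
Proof.
have [c [c1 Ec]] := sys_rep_mul A g h.
rewrite /sys_act !mulmxA Ec -[_ *m _^t* *m _]mulmxA -trmxC_mul Ec trmxCZ.
by rewrite -!scalemxAl -scalemxAr scalerA -normCK c1 expr1n scale1r.
Qed.

(** A projective representation fixes U(1) only up to a phase. The action of 1 is idempotent by
    [sys_actM] and invertible as a unitary conjugation, hence the identity. *)
Lemma sys_act1 A (L : op A) : act 1%g L = L.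
Proof.
have actK : act 1%g (act 1%g L) = act 1%g L by rewrite sys_actM mulg1.
have uV := sys_rep_unitary A 1%g; have uV' := unitarymx_unit uV.
move: actK; rewrite {1 3}/sys_act -invmx_unitary //.
move=> /(congr1 (mulmx^~ (sys_rep U A 1%g))).
rewrite !mulmxKV // => /(congr1 (mulmx (invmx (sys_rep U A 1%g)))).
by rewrite !mulKmx.
Qed.

Lemma sys_actK A g (L : op A) : act g^-1%g (act g L) = L.
Proof. by rewrite sys_actM mulVg sys_act1. Qed.

Lemma sys_actVK A g (L : op A) : act g (act g^-1%g L) = L.
Proof. by rewrite sys_actM mulgV sys_act1. Qed.

Lemma sys_act_tens A B g (K : op A) (L : op B) :
  sys_act U (A := Tens A B) g (K *t L) = act g K *t act g L.
Proof. by rewrite /sys_act /= trmxC_tens !tensmx_mul. Qed.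

Lemma sys_act_triv g (L : op Triv) : sys_act U (A := Triv) g L = L.
Proof. by rewrite /sys_act /= trmxC1 mul1mx mulmx1. Qed.

Lemma supp_proj_sys_act A g (L : op A) :
  supp_proj (act g L) = act g (supp_proj L).
Proof. exact: supp_proj_conj (sys_rep_unitary A g). Qed.

Lemma sys_act_mul A g (K L : op A) : act g K *m act g L = act g (K *m L).
Proof.
have uV := sys_rep_unitary A g; have uV' := unitarymx_unit uV.
rewrite /sys_act -invmx_unitary // !mulmxA; congr (_ *m _).
by rewrite mulmxKV // !mulmxA.
Qed.

Lemma cl_sym_subgroup A (rho : op A) (S : {set gT}) g :
  S = sym_subgroup U rho -> g \in S -> cl S g = cl S 1%g.
Proof.
move=> ->; rewrite inE => /eqP gS; apply: val_inj; apply/setP => h /=.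
rewrite !mem_lcoset invg1 mul1g !inE; apply/eqP/eqP => hS.
  by rewrite -[h](mulKVg g) -sys_actM hS.
by rewrite -sys_actM hS -{1}gS sys_actK.
Qed.

(** Since 1 is in S, equal cosets give h = g s with s in S, and the conjugation by s is absorbed by
    the covariance of E. *)
Lemma covariant_cl_eq (S : {set gT}) (X Y : system I) (E : op X -> op Y) g h :
  1%g \in S -> covariant U S E -> cl S g = cl S h ->
  act h \o E \o act h^-1%g = act g \o E \o act g^-1%g.
Proof.
move=> S1 covE /(congr1 val) /= gh.
have hS : (g^-1 * h)%g \in S.
  by rewrite -mem_lcoset gh mem_lcoset mulVg.
have -> : h = (g * (g^-1 * h))%g by rewrite mulKVg.
move: (g^-1 * h)%g hS => s hS; apply: funext => L /=.
rewrite -(sys_actM g s) invMg -(sys_actM s^-1).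
have /(congr1 (fun f => f (act s^-1%g (act g^-1%g L)))) /= <- := covE _ hS.
by rewrite sys_actVK.
Qed.

Definition twirl (X Y : system I) (E : op X -> op Y) (L : op X) : op Y :=
  #|gT|%:R^-1 *: \sum_(g : gT) act g (E (act g^-1%g L)).

Lemma twirl_covariant X Y (E : op X -> op Y) : covariant U [set: gT] (twirl E).
Proof.
move=> h _; apply: funext => L /=; rewrite /twirl sys_actZ sys_act_sum.
congr (_ *: _); rewrite (reindex_inj (mulgI h)) /=; apply: eq_bigr => g _.
by rewrite !sys_actM invMg mulgKV.
Qed.

Variable T : resource_theory R d.

Lemma free_op_twirl X Y (E : op X -> op Y) : convex_free_ops T ->
  compatible U T -> free_op T X Y E -> free_op T X Y (twirl E).
Proof.
move=> convT [_ compT] fE.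
have fg g : free_op T X Y (act g \o E \o act g^-1%g).
  by have := compT g X Y; move=> <-; exists E.
(* Convexity is binary, so uniform averages are built by induction: the average of n + 1 maps mixes
   the new one with weight 1/(n + 1) and the old average with weight n/(n + 1). *)
have avg (r : seq gT) : r != [::] -> free_op T X Y
    (fun L => (size r)%:R^-1 *: \sum_(g <- r) act g (E (act g^-1%g L))).
  elim: r => // g [|h r] IH _.
    have := fg g; congr (free_op T X Y _); apply: funext => L.
    by rewrite big_seq1 invr1 scale1r.
  have /(_ isT) {}IH := IH; set n := size (h :: r) in IH.
  have n0 : (n.+1%:R : R) != 0 by rewrite pnatr_eq0.
  have p01 : 0 <= (n.+1%:R^-1 : R) <= 1.
    by rewrite invr_ge0 ler0n invf_le1 ?ltr0n // ler1n.
  have := convT _ _ _ _ _ p01 (fg g) IH.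
  congr (free_op T X Y _); apply: funext => L /=.
  rewrite [in RHS]big_cons scalerDr; congr (_ + _).
    by rewrite fmorphV rmorph_nat.
  rewrite scalerA; congr (_ *: _).
  have -> : 1 - n.+1%:R^-1 = n%:R / n.+1%:R :> R.
    by rewrite -{1}(divff n0) -{2}[n.+1%:R^-1]mul1r -mulrBl -natr1 addrK.
  rewrite rmorphM fmorphV !rmorph_nat mulrAC divff ?mul1r //.
  by rewrite pnatr_eq0.
have := avg (enum gT); rewrite -cardT; set b := _ != _.
have -> : b by rewrite /b -size_eq0 -cardT -lt0n; apply/card_gt0P; exists 1%g.
move=> /(_ isT); congr (free_op T X Y _); apply: funext => L.
by rewrite /twirl big_enum.
Qed.

End Symmetries.

(** * The individual implications between the five statements *)

Section Implications.
Local Open Scope sesquilinear_scope.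
Variables (R : realType) (gT : finGroupType) (I : Type) (d : I -> nat).
Variable U : forall i : I, proj_urep R gT (d i).
Local Notation C := R[i].
Local Notation op A := 'M[C]_(hdim d A).
Local Notation act := (sys_act U).
Variable T : resource_theory R d.

(** Adjoin sigma to the trivial system, then discard the trivial factor: [Tens Triv B] and [B] are
    formally different systems. *)
Lemma free_op_prepare (B : system I) (sigma : op B) :
  ancilla_preparation T -> discarding_closed T -> free_state T B sigma ->
  free_op T Triv B (fun L => \tr L *: sigma).
Proof.
move=> ancT disT fsigma.
have := free_op_comp (ancT Triv _ _ fsigma).1 (disT B Triv).2.
by congr (free_op T _ _ _); apply: funext => L /=; rewrite ptrace_l_tens.
Qed.

Variables (Delta : distinguishability_measure R) (eps : R).
Hypothesis eps_range : 0 <= eps < 1.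
Hypothesis Delta_incr : strictly_increasing_odf Delta.
Variables (A : system I) (rho : op A).
Hypothesis rho_state : is_state rho.

(** An S-invariant state is an S-covariant preparation from the trivial system. Convert that
    operation and feed in the unit state, on which the group acts trivially. *)
Lemma state_conversion_of_op_conversion (S : {set gT}) (B : system I) (sigma : op B) :
  ancilla_preparation T -> discarding_closed T ->
  (forall (X Y : system I) (E : op X -> op Y),
     free_op T X Y E -> covariant U S E ->
     exists F : op (Tens A X) -> op Y,
       [/\ free_op T (Tens A X) Y F, covariant U [set: gT] F
         & forall chi : op X, is_state chi ->
             (Delta _ (E chi) (F (rho *t chi))
                <= odf Delta (- ln (1 - eps))%:E)%E]) ->
  free_state T B sigma -> invariant_state U S sigma ->
  exists F : op A -> op B,
    [/\ free_op T A B F, covariant U [set: gT] F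
      & (Delta _ sigma (F rho) <= odf Delta (- ln (1 - eps))%:E)%E].
Proof.
move=> ancT disT conv fsigma isigma.
have covE : covariant U S (A := Triv) (fun L => \tr L *: sigma).
  move=> g gS; apply: funext => L /=.
  by rewrite (@sys_act_triv _ _ _ _ U) sys_actZ isigma.
have [F [fF covF dF]] := conv _ _ _ (free_op_prepare ancT disT fsigma) covE.
have st1 : is_state (1%:M : op Triv).
  by split; [exact: psd1|exact: mxtrace1].
exists (fun L => F (L *t (1%:M : op Triv))); split.
- exact: free_op_comp (ancT A Triv _ (free_state_triv T)).1 fF.
- move=> g gG; apply: funext => L /=.
  have := congr1 (fun f => f (L *t (1%:M : op Triv))) (covF g gG) => /= <-.
  by rewrite sys_act_tens sys_act_triv.
- by have := dF _ st1; rewrite mxtrace1 scale1r.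
Qed.

Variables (S : {set gT}) (M : system I) (omega : quo S -> op M).

(** The adjoint of a channel is unital, so the missing part of the identity is the adjoint image of
    Pi_bot, which is positive. *)
Lemma sub_povm_of_memory_op (E : op A -> op M) (om_bot : op M) :
  \sum_(x : quo S) supp_proj (omega x) + supp_proj om_bot = 1%:M ->
  cptp E ->
  sub_povm (fun x : quo S => hs_adjoint E (supp_proj (omega x))).
Proof.
move=> sumP cE; split=> [x|]; first exact: hs_adjoint_psd (supp_proj_psd _).
rewrite -hs_adjoint_sum -(hs_adjoint1 cE) -hs_adjointB -sumP addrC addKr.
exact: hs_adjoint_psd (supp_proj_psd _).
Qed.

Lemma success_prob_hs_adjoint (E : op A -> op M) g : cptp E ->
  \tr (supp_proj (omega (cl S g)) *m E (act g rho)) =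
  (success_prob U rho (fun x => hs_adjoint E (supp_proj (omega x))) g)%:C.
Proof.
move=> cE; have [pg _] := sys_act_state U g rho_state.
rewrite /success_prob hs_adjoint_trace //.
by apply: psd_trace_real; [exact: supp_proj_psd|exact: cptp_psd].
Qed.

(** Covariance moves U_g through F, and Pi_(gS) is the U_g-image of Pi_S; the unitaries cancel in
    the trace, leaving tr(Pi_S F(rho)) for every g. *)
Lemma success_prob_covariant (F : op A -> op M) g :
  is_memory U omega -> cptp F -> covariant U [set: gT] F ->
  (Delta _ (omega (cl S 1%g)) (F rho) <= odf Delta (- ln (1 - eps))%:E)%E ->
  1 - eps <= success_prob U rho (fun x => hs_adjoint F (supp_proj (omega x))) g.
Proof.
move=> [stom actom _] cF covF dle.
rewrite -lecR -success_prob_hs_adjoint //.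
have -> : F (act g rho) = act g (F rho).
  by have := congr1 (fun f => f rho) (covF g (finset.in_setT g)).
rewrite -[g in cl S g]mulg1 -actom supp_proj_sys_act sys_act_mul sys_act_trace.
have [pF _] := cptp_state cF rho_state.
rewrite (psd_trace_real (supp_proj_psd _) pF) lecR.
apply: (trace_ge_of_dist_le Delta_incr eps_range (stom (cl S 1%g))
  (cptp_state cF rho_state) (supp_proj_psd _)) dle.
- have [hP pP _] := supp_projP (omega (cl S 1%g)).
  apply: psd_proj; first by rewrite linearB map_mxB /= trmxC1 hP.
  by rewrite mulmxBl mul1mx mulmxBr mulmx1 pP subrr subr0.
- by case: (stom (cl S 1%g)) => pom tom; rewrite supp_proj_trace.
Qed.

Lemma op_conversion_of_avg_success (X Y : system I) (E : op X -> op Y)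
    (E0 : op A -> op M) :
  tensor_closed T -> discarding_closed T -> convex_free_ops T -> compatible U T ->
  1%g \in S -> free_memory T omega -> free_op T A M E0 ->
  1 - eps <= #|gT|%:R^-1 * \sum_(g : gT)
    success_prob U rho (fun x => hs_adjoint E0 (supp_proj (omega x))) g ->
  free_op T X Y E -> covariant U S E ->
  exists F : op (Tens A X) -> op Y,
    [/\ free_op T (Tens A X) Y F, covariant U [set: gT] F
      & forall chi : op X, is_state chi ->
         (Delta _ (E chi) (F (rho *t chi)) <= odf Delta (- ln (1 - eps))%:E)%E].
Proof.
move=> tenT disT convT compT S1 [om_bot] /=.
set om := ext_memory omega om_bot => -[stbot _ sumP fom [fD ctrl]] fE0 succ fE covE.
pose P y := supp_proj (om y).
have cE := free_op_cptp fE; have cE0 := free_op_cptp fE0.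
(* The representative picked in each coset is immaterial by [covariant_cl_eq]. On [None] any free
   operation will do, since that outcome only contributes to [rest]. *)
pose Ey (y : option (quo S)) : op X -> op Y :=
  if y is Some x then
    let h := odflt 1%g [pick h | cl S h == x] in act h \o E \o act h^-1%g
  else E.
have fEy y : free_op T X Y (Ey y).
  case: y => [x|] //=; set h := odflt _ _.
  by have := compT.2 h X Y => <-; exists E.
have EyE g : Ey (Some (cl S g)) = act g \o E \o act g^-1%g.
  rewrite /Ey; case: pickP => [h /eqP hg|/(_ g)]; last by rewrite eqxx.
  exact: covariant_cl_eq covE _.
have [Cc fC CcE] := ctrl _ _ _ fEy.
(* The controlled operation is specified only on products with some [om y], so the output of [E0] is
   first brought to a mixture of these. *)
pose D := (fun L : op M => \sum_y \tr (P y *m L) *: om y).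
pose F0 : op (Tens A X) -> op Y :=
  @ptrace_l R (hdim d M) (hdim d Y) \o (Cc \o tensmap (D \o E0) (@id (op X))).
have fF0 : free_op T (Tens A X) Y F0.
  apply: free_op_comp (disT Y M).2; apply: free_op_comp fC.
  by apply: tenT.2; [exact: free_op_comp fE0 fD|exact: free_op_id].
have omst y : is_state (om y) by exact: free_state_is_state (fom y).1.
have F0E (K : op A) (L : op X) :
    F0 (K *t L) = \sum_y \tr (P y *m E0 K) *: Ey y L.
  have [linDE _ _] := free_op_cptp (free_op_comp fE0 fD).
  have [linC _ _] := free_op_cptp fC.
  have [linP _ _] := free_op_cptp (disT Y M).2.
  rewrite /F0 /= tensmap_tens // /D /= tensmx_suml.
  rewrite (linear_sum_fun _ _ _ linC) (linear_sum_fun _ _ _ linP).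
  apply: eq_bigr => y _; rewrite tensmxZl.
  rewrite (linear_scale_fun _ _ linC) CcE (linear_scale_fun _ _ linP).
  by rewrite ptrace_l_tens (omst y).2 scale1r.
have fF := free_op_twirl convT compT fF0.
exists (twirl U F0); split=> //; first exact: twirl_covariant.
move=> chi stchi.
have trF : \tr (twirl U F0 (rho *t chi)) = 1.
  have [_ _ ->] := free_op_cptp fF; have [_ _ <-] := free_op_cptp (disT X A).2.
  by rewrite ptrace_l_tens mxtraceZ rho_state.2 stchi.2 mulr1.
pose c : C := #|gT|%:R^-1.
set q : R := _ * _ in succ.
have c0 : 0 <= c by rewrite invr_ge0 ler0n.
(* The contribution of wrong guesses, about which only positivity is needed. *)
pose rest := c *: \sum_(g : gT) \sum_(y | y != Some (cl S g))
  \tr (P y *m E0 (act g rho)) *: act g^-1%g (Ey y (act g chi)).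
have FE : twirl U F0 (rho *t chi) = q%:C *: E chi + rest.
  (* After g -> g^-1 the inputs are U_g(rho) and U_g(chi). The correct outcome gS then yields
     U_g(E(chi)), which the outer U_g^-1 undoes, with weight the success probability at g. *)
  rewrite /twirl (reindex_inj invg_inj) /= /q rmorphM fmorphV rmorph_nat -/c.
  rewrite -scalerA -scalerDr; congr (_ *: _).
  rewrite rmorph_sum scaler_suml -big_split /=; apply: eq_bigr => g _.
  rewrite invgK (@sys_act_tens _ _ _ _ U A X) F0E sys_act_sum.
  rewrite (bigD1 (Some (cl S g))) // EyE /= !sys_actK -success_prob_hs_adjoint //.
  rewrite sys_actZ sys_actK; congr (_ + _).
  by apply: eq_bigr => y _; rewrite sys_actZ.
rewrite FE; apply: dist_le_of_mixture => //.
- exact: cptp_state.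
- apply: psdZ => //; apply: psd_sum => g _; apply: psd_sum => y _; apply: psdZ.
    apply: psd_trace_mul; first exact: supp_proj_psd.
    by apply: cptp_psd => //; apply: sys_act_psd; case: rho_state.
  apply: sys_act_psd; apply: cptp_psd (free_op_cptp (fEy y)) _.
  by apply: sys_act_psd; case: stchi.
- by rewrite -FE.
Qed.

End Implications.

Theorem theorem5 (R : realType) (gT : finGroupType)
    (I : Type) (d : I -> nat) (U : forall i : I, proj_urep R gT (d i))
    (T : resource_theory R d)
    (T_tensor : tensor_closed T) (T_ancilla : ancilla_preparation T)
    (T_discard : discarding_closed T) (T_convex : convex_free_ops T)
    (T_compat : compatible U T)
    (eps : R) (eps_range : 0 <= eps < 1)
    (Delta : distinguishability_measure R)
    (Delta_incr : strictly_increasing_odf Delta)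
    (A : system I) (rho : 'M[R[i]]_(hdim d A)) (rho_state : is_state rho)
    (S : {set gT}) (S_def : S = sym_subgroup U rho)
    (M : system I) (omega : quo S -> 'M[R[i]]_(hdim d M))
    (omega_memory : is_memory U omega)
    (omega_free : free_memory T omega) :
  [<-> forall (X Y : system I) (E : 'M[R[i]]_(hdim d X) -> 'M[R[i]]_(hdim d Y)),
         free_op T X Y E -> covariant U S E ->
         exists F : 'M[R[i]]_(hdim d (Tens A X)) -> 'M[R[i]]_(hdim d Y),
           [/\ free_op T (Tens A X) Y F, covariant U [set: gT] F
             & forall chi : 'M[R[i]]_(hdim d X), is_state chi ->
                 (Delta _ (E chi) (F (rho *t chi))
                    <= odf Delta (- ln (1 - eps))%:E)%E];
       forall (B : system I) (sigma : 'M[R[i]]_(hdim d B)),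
         free_state T B sigma -> invariant_state U S sigma ->
         exists F : 'M[R[i]]_(hdim d A) -> 'M[R[i]]_(hdim d B),
           [/\ free_op T A B F, covariant U [set: gT] F
             & (Delta _ sigma (F rho) <= odf Delta (- ln (1 - eps))%:E)%E];
       exists F : 'M[R[i]]_(hdim d A) -> 'M[R[i]]_(hdim d M),
         [/\ free_op T A M F, covariant U [set: gT] F
           & (Delta _ (omega (cl S 1%g)) (F rho)
                <= odf Delta (- ln (1 - eps))%:E)%E];
       exists N : quo S -> 'M[R[i]]_(hdim d A),
         [/\ sub_povm N, memory_assisted T omega N
           & 1 - eps <= \big[Num.min/success_prob U rho N 1%g]_(g : gT)
                          success_prob U rho N g];
       exists N : quo S -> 'M[R[i]]_(hdim d A),
         [/\ sub_povm N, memory_assisted T omega N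
           & 1 - eps <= #|gT|%:R^-1 * \sum_(g : gT) success_prob U rho N g]].
Proof.
have oneS : 1%g \in S by rewrite S_def inE sys_act1.
have [omst actom _] := omega_memory.
have [om_bot [_ _ sumP fom _]] := omega_free.
apply: AllIffConj => [opconv B sigma|].
  exact: state_conversion_of_op_conversion opconv.
apply: AllIffConj => [stconv|].
  apply: stconv; first exact: (fom (Some (cl S 1%g))).1.
  (* The action of g takes omega_S to omega_(gS), and gS = S for g in the stabilizer. *)
  by move=> g gS; rewrite actom mulg1 (cl_sym_subgroup S_def gS).
apply: AllIffConj => [[F [fF covF dF]]|].
  have cF := free_op_cptp fF.
  exists (fun x => hs_adjoint F (supp_proj (omega x))); split.
  - exact: sub_povm_of_memory_op sumP cF.
  - by exists F.
  (* Both the starting value of the minimum, which is the value at 1, and every term obey the same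
     bound. *)
  - apply: le_bigmin => [|g _];
      exact: (success_prob_covariant eps_range Delta_incr rho_state).
apply: AllIffConj => [[N [povmN memN leN]]|].
  exists N; split=> //; rewrite mulrC ler_pdivlMr ?ltr0n; last first.
    by apply/card_gt0P; exists 1%g.
  rewrite mulr_natr -sumr_const; apply: ler_sum => g _.
  by apply: le_trans leN _; exact: bigmin_le.
move=> [N [_ [E0 fE0 NE] leN]] X Y E.
apply: (op_conversion_of_avg_success eps_range Delta_incr rho_state T_tensor
  T_discard T_convex T_compat oneS omega_free fE0).
have <- : N = fun x => hs_adjoint E0 (supp_proj (omega x)) by exact: funext.
exact: leN.
Qed.
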